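(* Let $Q=Q_0+sQ_1\in\mathbb{H}_{\ast 1}$ (with $Q_0,Q_1\in\mathbb{H}[t]$) be a monic polynomial with $\gcd(Q)=1$ that admits a factorization $$Q=(t-h_1)\cdots(t-h_n)(s-h)(t-k_1)\cdots(t-k_m),\qquad h_1,\dots,h_n,h,k_1,\dots,k_m\in\mathbb{H}.$$ Put $M_i=(t-h_i)(t-h_i)^\ast\in\mathbb{R}[t]$ for $i=1,\dots,n$, $N_j=(t-k_j)(t-k_j)^\ast\in\mathbb{R}[t]$ for $j=1,\dots,m$, and $P=M_1\cdots M_nN_1\cdots N_m$. Let $z\in\mathbb{C}$ be a zero of $P$. (a) If there exists $j\in\{1,\dots,m\}$ with $N_j(z)=0$, then $[Q_0(z)]\vee[Q_1(z)]$ is contained in a left ruling. (b) If there exists $i\in\{1,\dots,n\}$ with $M_i(z)=0$, then $[Q_0(z)]\vee[Q_1(z)]$ is contained in a right ruling.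
   Context: $\mathbb{H}$ is the skew field of real quaternions with units $\mathbf{i},\mathbf{j},\mathbf{k}$; $\mathbb{H}[t,s]$ is the ring of polynomials in which $t,s$ commute with each other and with all coefficients. $Q^\ast$ is obtained by conjugating all coefficients. $\mathbb{H}_{\ast 1}$ is the set of polynomials $Q=Q_0+sQ_1$ with $Q_0,Q_1\in\mathbb{H}[t]$. $Q$ is monic if, viewed as a polynomial in $s$ over $\mathbb{H}[t]$, its leading coefficient is a monic polynomial in $t$. $\gcd(Q)$ is the monic greatest common divisor in $\mathbb{R}[t,s]$ of the four real coordinate polynomials of $Q$ with respect to $1,\mathbf{i},\mathbf{j},\mathbf{k}$. $\mathbb{C}\mathbb{H}=\mathbb{C}\otimes_{\mathbb{R}}\mathbb{H}$ is the algebra of complex quaternions $h=h_0+h_1\mathbf{i}+h_2\mathbf{j}+h_3\mathbf{k}$ with $h_\ell\in\mathbb{C}$ (complex scalars commute with $\mathbf{i},\mathbf{j},\mathbf{k}$), with $\mathbb{C}$-linear conjugation $h^\ast=h_0-h_1\mathbf{i}-h_2\mathbf{j}-h_3\mathbf{k}$. For $z\in\mathbb{C}$, $Q_\ell(z)\in\mathbb{C}\mathbb{H}$ is obtained by substituting $t=z$. $\mathbb{P}(\mathbb{C}\mathbb{H})=\mathbb{P}^3(\mathbb{C})$, and $[q]$ denotes the point represented by $q\neq0$. $[Q_0(z)]\vee[Q_1(z)]$ denotes the projective span of $Q_0(z)$ and $Q_1(z)$: the connecting line if $[Q_0(z)]\neq[Q_1(z)]$ are both defined, the common point if they coincide, and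 if exactly one of $Q_0(z),Q_1(z)$ is $0$, the point represented by the other one. (Both being zero is impossible when $\gcd(Q)=1$.) The null quadric is $\mathcal{N}=\{[h]\in\mathbb{P}(\mathbb{C}\mathbb{H}): hh^\ast=0\}$. For $[h]\in\mathcal{N}$, the left ruling through $[h]$ is the line $L_{[h]}=\{[q]: qh^\ast=0\}$ and the right ruling through $[h]$ is the line $R_{[h]}=\{[q]: h^\ast q=0\}$. A left (right) ruling is a line of the form $L_{[h]}$ (respectively $R_{[h]}$) for some $[h]\in\mathcal{N}$. *)

(* Defs.v *)
From HB Require Import structures.
From mathcomp Require Import all_boot all_order all_algebra all_field.
From mathcomp Require Import reals complex ring.

Set Implicit Arguments.
Unset Strict Implicit.
Unset Printing Implicit Defensive.

Import GRing.Theory.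
Local Open Scope ring_scope.

(** * Quaternions over a commutative ring

    [quat R] is the algebra of real quaternions for R the reals, and
    [quat R[i]] is the algebra of complex quaternions. The ring operations
    are the usual Hamilton ones, the module structure is the scalar extension
    one (scalars commute with the units i, j, k). *)

Record quat (R : Type) := Quat { qr : R; qi : R; qj : R; qk : R }.

Section QuatChoice.
Variable R : Type.
Definition quat_to_tuple (x : quat R) := (qr x, qi x, qj x, qk x).
Definition quat_of_tuple (u : R * R * R * R) :=
  let: (a, b, c, d) := u in Quat a b c d.
Lemma quat_to_tupleK : cancel quat_to_tuple quat_of_tuple.
Proof. by case. Qed.
End QuatChoice.

HB.instance Definition _ (R : eqType) :=
  Equality.copy (quat R) (can_type (@quat_to_tupleK R)).
HB.instance Definition _ (R : choiceType) :=
  Choice.copy (quat R) (can_type (@quat_to_tupleK R)).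

Section QuatAlgebra.
Variable R : comNzRingType.
Implicit Types x y : quat R.

Definition quat_add x y :=
  Quat (qr x + qr y) (qi x + qi y) (qj x + qj y) (qk x + qk y).
Definition quat_opp x := Quat (- qr x) (- qi x) (- qj x) (- qk x).
Definition quat_zero : quat R := Quat 0 0 0 0.
Definition quat_one : quat R := Quat 1 0 0 0.
Definition quat_mul x y := Quat
  (qr x * qr y - qi x * qi y - qj x * qj y - qk x * qk y)
  (qr x * qi y + qi x * qr y + qj x * qk y - qk x * qj y)
  (qr x * qj y - qi x * qk y + qj x * qr y + qk x * qi y)
  (qr x * qk y + qi x * qj y - qj x * qi y + qk x * qr y).
Definition quat_scale (a : R) x :=
  Quat (a * qr x) (a * qi x) (a * qj x) (a * qk x).

Fact quat_addqA : associative quat_add.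
Proof. by move=> [????] [????] [????]; rewrite /quat_add /= !addrA. Qed.
Fact quat_addqC : commutative quat_add.
Proof. by move=> [????] [????]; congr Quat; rewrite /= addrC. Qed.
Fact quat_add0q : left_id quat_zero quat_add.
Proof. by move=> [????]; rewrite /quat_add /= !add0r. Qed.
Fact quat_addNq : left_inverse quat_zero quat_opp quat_add.
Proof. by move=> [????]; rewrite /quat_add /= !addNr. Qed.
HB.instance Definition _ :=
  GRing.isZmodule.Build (quat R) quat_addqA quat_addqC quat_add0q quat_addNq.

Fact quat_mulqA : associative quat_mul.
Proof. by move=> [????] [????] [????]; congr Quat => /=; ring. Qed.
Fact quat_mul1q : left_id quat_one quat_mul.
Proof. by move=> [????]; congr Quat => /=; ring. Qed.
Fact quat_mulq1 : right_id quat_one quat_mul.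
Proof. by move=> [????]; congr Quat => /=; ring. Qed.
Fact quat_mulqDl : left_distributive quat_mul quat_add.
Proof. by move=> [????] [????] [????]; congr Quat => /=; ring. Qed.
Fact quat_mulqDr : right_distributive quat_mul quat_add.
Proof. by move=> [????] [????] [????]; congr Quat => /=; ring. Qed.
Fact quat_oneq_neq0 : quat_one != quat_zero.
Proof. by apply/eqP=> -[/eqP]; rewrite oner_eq0. Qed.
HB.instance Definition _ := GRing.Zmodule_isNzRing.Build (quat R)
  quat_mulqA quat_mul1q quat_mulq1 quat_mulqDl quat_mulqDr quat_oneq_neq0.

Fact quat_scaleqA a b x : quat_scale a (quat_scale b x) = quat_scale (a * b) x.
Proof. by rewrite /quat_scale /= !mulrA. Qed.
Fact quat_scale1q : left_id 1 quat_scale.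
Proof. by move=> [????]; rewrite /quat_scale /= !mul1r. Qed.
Fact quat_scaleqDr : right_distributive quat_scale +%R.
Proof. by move=> a [????] [????]; rewrite /quat_scale /= !mulrDr. Qed.
Fact quat_scaleqDl x : {morph quat_scale^~ x : a b / a + b}.
Proof. by move=> a b; rewrite /quat_scale /= !mulrDl. Qed.
HB.instance Definition _ := GRing.Zmodule_isLmodule.Build R (quat R)
  quat_scaleqA quat_scale1q quat_scaleqDr quat_scaleqDl.

Fact quat_scaleqAl (a : R) x y : a *: (x * y) = (a *: x) * y.
Proof. by case: x y => [????] [????]; congr Quat => /=; ring. Qed.
HB.instance Definition _ := GRing.Lmodule_isLalgebra.Build R (quat R)
  quat_scaleqAl.
Fact quat_scaleqAr (a : R) x y : a *: (x * y) = x * (a *: y).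
Proof. by case: x y => [????] [????]; congr Quat => /=; ring. Qed.
HB.instance Definition _ := GRing.Lalgebra_isAlgebra.Build R (quat R)
  quat_scaleqAr.

Definition row_of_quat x : 'rV[R]_4 :=
  \row_(j < 4) nth 0 [:: qr x; qi x; qj x; qk x] j.
Fact quat_vect_axiom : Vector.axiom 4 (quat R).
Proof.
exists row_of_quat.
  move=> a x y; apply/rowP=> j; rewrite !mxE.
  by case: j => [[|[|[|[|?]]]] ?].
exists (fun v : 'rV[R]_4 => Quat (v 0 (inord 0)) (v 0 (inord 1))
                      (v 0 (inord 2)) (v 0 (inord 3))).
  by case=> *; rewrite !mxE !inordK.
move=> v; apply/rowP=> j; rewrite !mxE.
by case: j => [[|[|[|[|?]]]] ?] //=; congr (v _ _); apply: val_inj;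
  rewrite /= inordK.
Qed.
HB.instance Definition _ :=
  Lmodule_hasFinDim.Build R (quat R) quat_vect_axiom.

(* On complex quaternions this is the C-linear conjugation: the complex
   coordinates are not conjugated. *)
Definition qconj x := Quat (qr x) (- qi x) (- qj x) (- qk x).

End QuatAlgebra.

HB.instance Definition _ (F : fieldType) := Algebra_isFalgebra.Build F (quat F).

(** * Quaternionic polynomials

    [{poly quat R}] is H[t]; H[t,s] is [{poly {poly quat R}}], the ring of
    polynomials in s (outer variable) over H[t]. In MathComp, the variable
    of a polynomial ring commutes with all coefficients, also when these do
    not commute with each other. *)

Section QuatPoly.
Variable R : comNzRingType.

Definition pconj (p : {poly quat R}) : {poly quat R} := map_poly (@qconj R) p.

(* p p^* has real coefficients, see [qnorm_polyE]: this is p p^* as an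
   element of R[t]. *)
Definition qnorm_poly (p : {poly quat R}) : {poly R} :=
  map_poly (@qr R) (p * pconj p).

Definition qcoords (Q : {poly {poly quat R}}) : seq {poly {poly R}} :=
  [seq map_poly (map_poly f) Q | f <- [:: @qr R; @qi R; @qj R; @qk R]].

End QuatPoly.

(* The leading coefficient with respect to s is a monic polynomial in t. *)
Definition bimonic (A : nzRingType) (p : {poly {poly A}}) : bool :=
  lead_coef p \is monic.

(* Divisibility in R[t,s]. The relation %| of polydiv is not suitable here: it
   is pseudo-divisibility, i.e. divisibility over the field R(t). *)
Definition bidvd (R : comNzRingType) (d p : {poly {poly R}}) : Prop :=
  exists e, p = e * d.

Definition is_qgcd (R : comNzRingType) (Q : {poly {poly quat R}})
    (d : {poly {poly R}}) : Prop :=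
  [/\ bimonic d,
      forall c, c \in qcoords Q -> bidvd d c
    & forall e, (forall c, c \in qcoords Q -> bidvd e c) -> bidvd e d].

(** * Evaluation at complex numbers *)

Section Evaluation.
Variable R : realType.

Definition quat_complex (x : quat R) : quat R[i] :=
  Quat (real_complex R (qr x)) (real_complex R (qi x))
       (real_complex R (qj x)) (real_complex R (qk x)).

Definition qpoly_at (p : {poly quat R}) (z : R[i]) : quat R[i] :=
  (map_poly quat_complex p).[z%:A].

Definition rpoly_at (p : {poly R}) (z : R[i]) : R[i] :=
  (map_poly (real_complex R) p).[z].

End Evaluation.

(** * Projective geometry of P(CH)

    A projective subspace of P(CH) is represented by the corresponding linear
    subspace, of type [{vspace quat C}]: the point [q] (for q != 0) is the line
    <[q]>, and inclusion of projective subspaces is inclusion of vspaces. *)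

Section NullQuadric.
Variable C : fieldType.
Implicit Types h q : quat C.

(* This also covers p = 0 (resp. q = 0), giving the point [q] (resp. [p]). *)
Definition proj_span p q : {vspace quat C} := (<[p]> + <[q]>)%VS.

Definition on_null_quadric h : bool := (h != 0) && (h * qconj h == 0).

Definition left_ruling_through h : {vspace quat C} := lker (amulr (qconj h)).
Definition right_ruling_through h : {vspace quat C} := lker (amull (qconj h)).

Definition is_left_ruling (L : {vspace quat C}) : Prop :=
  exists2 h, on_null_quadric h & L = left_ruling_through h.
Definition is_right_ruling (L : {vspace quat C}) : Prop :=
  exists2 h, on_null_quadric h & L = right_ruling_through h.

Lemma mem_left_ruling_through h q :
  (q \in left_ruling_through h) = (q * qconj h == 0).
Proof. by rewrite memv_ker lfunE. Qed.

Lemma mem_right_ruling_through h q :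
  (q \in right_ruling_through h) = (qconj h * q == 0).
Proof. by rewrite memv_ker lfunE. Qed.

End NullQuadric.

Section QnormPoly.
Variable R : realType.

Lemma qconjM (x y : quat R) : qconj (x * y) = qconj y * qconj x.
Proof. by case: x y => [????] [????]; congr Quat => /=; ring. Qed.

Lemma qconjK : involutive (@qconj R).
Proof. by case=> *; rewrite /qconj /= !opprK. Qed.

Lemma qconj_sum n (F : 'I_n -> quat R) :
  qconj (\sum_(i < n) F i) = \sum_(i < n) qconj (F i).
Proof.
apply: (big_morph (@qconj R)) => [x y|]; last by congr Quat; rewrite /= oppr0.
by congr Quat; rewrite /= ?opprD.
Qed.

Lemma qconj_real (x : quat R) : qconj x = x -> x = (qr x)%:A.
Proof.
case: x => a b c d [] eb ec ed.
have eqN0 (u : R) : - u = u -> u = 0.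
  by move/eqP; rewrite eq_sym -addr_eq0 -mulr2n Num.Theory.mulrn_eq0 /= => /eqP.
by congr Quat => /=; rewrite ?mulr1 // mulr0; apply: eqN0.
Qed.

Lemma qnorm_polyE (p : {poly quat R}) :
  map_poly (fun a : R => a%:A : quat R) (qnorm_poly p) = p * pconj p.
Proof.
have c0 : qconj (0 : quat R) = 0 by congr Quat; rewrite /= oppr0.
apply/polyP=> k; rewrite !coef_map_id0 ?scale0r //.
symmetry; apply: qconj_real; rewrite coefM qconj_sum.
rewrite (reindex_inj rev_ord_inj) /=; apply: eq_bigr => i _.
by rewrite !coef_map_id0 // qconjM qconjK subSS subKn // -ltnS.
Qed.

End QnormPoly.

(* Main.v *)
From HB Require Import structures.
Require Import Defs.
From mathcomp Require Import all_boot all_order all_algebra all_field.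
From mathcomp Require Import reals complex ring.
Set Implicit Arguments.
Unset Strict Implicit.
Unset Printing Implicit Defensive.
Import GRing.Theory.
Local Open Scope ring_scope.

(** Writing [A] and [B] for the products of the linear factors to the left and
    to the right of [s - h], one has [Q0 = - A h B] and [Q1 = A B]. If some
    [N_j] vanishes at [z], then [b = B(z)] satisfies [b b^* = 0] by
    multiplicativity of the norm, so both [Q0(z)] and [Q1(z)] are annihilated
    by [b^*] from the right. The case of [M_i] is symmetric, with [A(z)^*]
    acting from the left. *)

Section QuatNorm.
Variable R : comNzRingType.
Implicit Types x y : quat R.

(** Over [R[i]] this quadratic form is isotropic: its nonzero zeros are the representatives of the
    points of the null quadric. *)
Definition qnorm x : R := qr (x * qconj x).

Lemma mulq_conj x : x * qconj x = (qnorm x)%:A.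
Proof. by case: x => *; congr Quat; rewrite /= ?/qnorm /=; ring. Qed.

Lemma mulq_conjl x : qconj x * x = (qnorm x)%:A.
Proof. by case: x => *; congr Quat; rewrite /= ?/qnorm /=; ring. Qed.

Lemma qnormM : {morph qnorm : x y / x * y}.
Proof. by case=> [????] [????]; rewrite /qnorm /=; ring. Qed.

Lemma qnorm1 : qnorm 1 = 1.
Proof. by rewrite /qnorm /=; ring. Qed.

Lemma qnorm_prod_eq0 n (F : 'I_n -> quat R) (i : 'I_n) :
  qnorm (F i) = 0 -> qnorm (\prod_(j < n) F j) = 0.
Proof.
by move=> Fi0; rewrite (big_morph qnorm qnormM qnorm1) (bigD1 i) //= Fi0 mul0r.
Qed.

Fact qconj_is_linear : linear (@qconj R).
Proof. by move=> a [????] [????]; congr Quat; rewrite /= ?/qnorm /=; ring. Qed.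
HB.instance Definition _ :=
  GRing.isLinear.Build R (quat R) (quat R) *:%R (@qconj R) qconj_is_linear.

Fact qr_is_linear : scalar (@qr R).
Proof. by []. Qed.
HB.instance Definition _ :=
  GRing.isLinear.Build R (quat R) R *%R (@qr R) qr_is_linear.

End QuatNorm.

Section QpolyAt.
Variables (R : realType) (z : R[i]).
Implicit Types p q : {poly quat R}.

Fact quat_complex_is_zmod_morphism : zmod_morphism (@quat_complex R).
Proof. by move=> x y; congr Quat => /=; rewrite rmorphB. Qed.
HB.instance Definition _ := GRing.isZmodMorphism.Build _ _
  (@quat_complex R) quat_complex_is_zmod_morphism.

Fact quat_complex_is_monoid_morphism : monoid_morphism (@quat_complex R).
Proof.
split; first by congr Quat; rewrite /= ?rmorph0 ?rmorph1.
by move=> x y; congr Quat => /=; rewrite !(rmorphB, rmorphD, rmorphM).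
Qed.
HB.instance Definition _ := GRing.isMonoidMorphism.Build _ _
  (@quat_complex R) quat_complex_is_monoid_morphism.

(** The powers of the scalar point [z%:A] act by scaling, so a linear map on the coefficients can be
    pulled through evaluation term by term. *)
Lemma qpoly_atE p :
  qpoly_at p z = \sum_(i < size p) z ^+ i *: quat_complex p`_i.
Proof.
rewrite /qpoly_at (horner_coef_wide _ (size_poly _ _)).
apply: eq_bigr => i _.
by rewrite coef_map /= exprZn expr1n -scalerAr mulr1.
Qed.

(** Over a noncommutative ring evaluation need not be multiplicative; it is here because [z%:A] is
    central. *)
Lemma qpoly_atM p q : qpoly_at (p * q) z = qpoly_at p z * qpoly_at q z.
Proof.
rewrite /qpoly_at rmorphM hornerM_comm //.
by rewrite /comm_poly -scalerAl mul1r -scalerAr mulr1.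
Qed.

Lemma qpoly_at1 : qpoly_at 1 z = 1.
Proof. by rewrite /qpoly_at rmorph1 hornerC. Qed.

Lemma qpoly_at_prod n (F : 'I_n -> {poly quat R}) :
  qpoly_at (\prod_(i < n) F i) z = \prod_(i < n) qpoly_at (F i) z.
Proof. exact: (big_morph _ qpoly_atM qpoly_at1). Qed.

Lemma quat_complex_conj (x : quat R) :
  quat_complex (qconj x) = qconj (quat_complex x).
Proof. by congr Quat => /=; rewrite rmorphN. Qed.

(** Since [qconj] is linear over [R[i]], it leaves the powers of [z] alone, and the same [z] occurs
    on both sides. *)
Lemma qpoly_at_pconj p : qpoly_at (pconj p) z = qconj (qpoly_at p z).
Proof.
rewrite [in RHS]qpoly_atE raddf_sum /qpoly_at /pconj -map_poly_comp_id0 ?raddf0 //.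
(* The sum runs up to [size p], a bound on the size of the mapped polynomial, so that both sides
   have the same index set. *)
rewrite (horner_coef_wide _ (size_poly _ _)); apply: eq_bigr => i _.
rewrite coef_map_id0 /= ?quat_complex_conj ?rmorph0 ?raddf0 //.
by rewrite exprZn expr1n -scalerAr mulr1 linearZ.
Qed.

Lemma rpoly_at_qr p : rpoly_at (map_poly (@qr R) p) z = qr (qpoly_at p z).
Proof.
rewrite qpoly_atE raddf_sum /rpoly_at -map_poly_comp_id0 ?raddf0 //.
rewrite (horner_coef_wide _ (size_poly _ _)); apply: eq_bigr => i _.
by rewrite coef_map_id0 //= mulrC.
Qed.

Lemma rpoly_at_qnorm p : rpoly_at (qnorm_poly p) z = qnorm (qpoly_at p z).
Proof. by rewrite rpoly_at_qr qpoly_atM qpoly_at_pconj. Qed.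

End QpolyAt.

Section Rulings.
Variable R : realType.
Implicit Types b p q : quat R[i].

Lemma null_quadric_nonempty : exists b, on_null_quadric b.
Proof.
(* The complex unit ['i] is the coordinate at the first quaternion unit, so the norm is 1 + ['i]^2 =
   0. *)
exists (Quat 1 'i 0 0); apply/andP; split.
  by apply/eqP=> -[] /eqP; rewrite oner_eq0.
have ii : 'i * 'i = -1 :> R[i] by rewrite -expr2 Num.Theory.sqrCi.
by apply/eqP; congr Quat; rewrite /= ?mulrN ?ii; ring.
Qed.

(* When [b = 0] both points vanish, and any ruling will do. *)
Lemma sub_left_ruling b p q : qnorm b = 0 ->
  exists2 L : {vspace quat R[i]}, is_left_ruling L
    & (proj_span (p * b)%R (q * b)%R <= L)%VS.
Proof.
move=> b0; have [->|nz_b] := eqVneq b 0.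
  have [c c0] := null_quadric_nonempty.
  exists (left_ruling_through c); first by exists c.
  by rewrite /proj_span !mulr0 subv_add -!memvE mem0v.
have bb0 : b * qconj b = 0 by rewrite mulq_conj b0 scale0r.
exists (left_ruling_through b).
  by exists b; rewrite // /on_null_quadric nz_b bb0 /=.
by rewrite subv_add -!memvE !mem_left_ruling_through -!mulrA bb0 !mulr0 eqxx.
Qed.

(** Mirror image of [sub_left_ruling]: membership now rests on [qconj b * b = 0], while lying on the
    null quadric is still a condition on [b * qconj b]; both products equal the norm. *)
Lemma sub_right_ruling b p q : qnorm b = 0 ->
  exists2 L : {vspace quat R[i]}, is_right_ruling L
    & (proj_span (b * p)%R (b * q)%R <= L)%VS.
Proof.
move=> b0; have [->|nz_b] := eqVneq b 0.
  have [c c0] := null_quadric_nonempty.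
  exists (right_ruling_through c); first by exists c.
  by rewrite /proj_span !mul0r subv_add -!memvE mem0v.
exists (right_ruling_through b).
  by exists b; rewrite // /on_null_quadric nz_b mulq_conj b0 scale0r /=.
by rewrite subv_add -!memvE !mem_right_ruling_through !mulrA mulq_conjl b0
  scale0r !mul0r eqxx.
Qed.

End Rulings.

Theorem theorem5p2 (R : realType) (Q : {poly {poly quat R}})
    (Q0 Q1 : {poly quat R}) (n m : nat)
    (h_ : 'I_n -> quat R) (h : quat R) (k_ : 'I_m -> quat R) (z : R[i])
    (QE : Q = Q0%:P + 'X * Q1%:P)
    (Qmonic : bimonic Q)
    (Qgcd : is_qgcd Q 1)
    (Qfact : Q = \prod_(i < n) ('X - (h_ i)%:P)%:P
                 * ('X - h%:P%:P)
                 * \prod_(j < m) ('X - (k_ j)%:P)%:P) :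
  let M (i : 'I_n) : {poly R} := qnorm_poly ('X - (h_ i)%:P) in
  let N (j : 'I_m) : {poly R} := qnorm_poly ('X - (k_ j)%:P) in
  let P : {poly R} := \prod_(i < n) M i * \prod_(j < m) N j in
  rpoly_at P z = 0 ->
  ((exists j : 'I_m, rpoly_at (N j) z = 0) ->
     exists2 L : {vspace quat R[i]}, is_left_ruling L
       & (proj_span (qpoly_at Q0 z) (qpoly_at Q1 z) <= L)%VS)
  /\
  ((exists i : 'I_n, rpoly_at (M i) z = 0) ->
     exists2 L : {vspace quat R[i]}, is_right_ruling L
       & (proj_span (qpoly_at Q0 z) (qpoly_at Q1 z) <= L)%VS).
Proof.
move=> M N P _.
pose A := \prod_(i < n) ('X - (h_ i)%:P).
pose B := \prod_(j < m) ('X - (k_ j)%:P).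
have {}Qfact : Q0%:P + 'X * Q1%:P = A%:P * ('X - h%:P%:P) * B%:P.
  by rewrite -QE Qfact !rmorph_prod.
have Q0E : Q0 = A * - h%:P * B.
  (* The outer variable is s, so this compares the coefficients of s^0; those of s^1 give [Q1]
     below. *)
  have /(congr1 (fun p : {poly _} => p`_0)) := Qfact.
  by rewrite coefMC coefCM coefD coefB coefMC !coefC !coefX /= mul0r addr0 sub0r.
have Q1E : Q1 = A * B.
  have /(congr1 (fun p : {poly _} => p`_1)) := Qfact.
  by rewrite coefMC coefCM coefD coefB coefMC !coefC !coefX /=
    mul1r add0r subr0 mulr1.
split=> -[l]; rewrite rpoly_at_qnorm.
  move/(qnorm_prod_eq0 (F := fun j => qpoly_at ('X - (k_ j)%:P) z)).
  (* Only the common right factor [B] is split off; the values of [A * - h%:P] and [A] serve as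
     arbitrary cofactors. *)
  by rewrite -qpoly_at_prod Q0E Q1E !(qpoly_atM _ _ B); apply: sub_left_ruling.
move/(qnorm_prod_eq0 (F := fun i => qpoly_at ('X - (h_ i)%:P) z)).
(* Reassociating exposes [A] as the common left factor, with cofactors [- h%:P * B] and [B]. *)
rewrite -qpoly_at_prod Q0E Q1E -(mulrA A) !(qpoly_atM _ A).
exact: sub_right_ruling.
Qed.
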